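(* Let $A\Rightarrow M$ be a Lie algebroid and $(V,\nabla^A)$ a representation of $A$. An $A$-invariant connection $\nabla$ on $V$ induces an operator on $V$-valued IM forms, $$d^\nabla_{\mathrm{IM}}:\Omega^k_{\mathrm{IM}}(A,V)\to\Omega^{k+1}_{\mathrm{IM}}(A,V),\qquad(L,l)\mapsto(d^\nabla L,\;L-d^\nabla l).$$ If $\nabla$ is flat, this operator is a differential, i.e. $d^\nabla_{\mathrm{IM}}\circ d^\nabla_{\mathrm{IM}}=0$.
   Context: $A\Rightarrow M$ has bracket $[\cdot,\cdot]$ and anchor $\rho$. A representation of $A$ is a vector bundle $V\to M$ with a flat $A$-connection $\nabla^A$. A (usual) linear connection $\nabla$ on $V$ is $A$-invariant if $\nabla^A_a=\nabla_{\rho(a)}$ and $R^\nabla(\rho(a),v)=0$ for all $x\in M$, $a\in A_x$, $v\in T_xM$, where $R^\nabla$ is the curvature of $\nabla$. A $V$-valued IM $k$-form is a pair $(L,l)$, with $L:\Gamma(A)\to\Omega^k(M,V)$ linear and $l:A\to\wedge^{k-1}T^*M\otimes V$ a vector bundle map, such that for all $f\in C^\infty(M)$, $\alpha,\beta\in\Gamma(A)$: $L(f\alpha)=fL(\alpha)+df\wedge l(\alpha)$ and $$i_{\rho(\alpha)}l(\beta)=-i_{\rho(\beta)}l(\alpha),\quad L([\alpha,\beta])=\mathcal{L}_\alpha L(\beta)-\mathcal{L}_\beta L(\alpha),\quad l([\alpha,\beta])=\mathcal{L}_\alpha l(\beta)-i_{\rho(\beta)}L(\alpha),$$ where $\mathcal{L}_\alpha\gamma(X_1,\dots,X_k):=\nabla^A_\alpha(\gamma(X_1,\dots,X_k))-\sum_{i}\gamma(X_1,\dots,[\rho(\alpha),X_i],\dots,X_k)$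 for $\gamma\in\Omega^k(M,V)$. The space of these is $\Omega^k_{\mathrm{IM}}(A,V)$. $d^\nabla$ is the covariant exterior derivative on $\Omega^\bullet(M,V)$; $d^\nabla L$ and $d^\nabla l$ denote $\alpha\mapsto d^\nabla(L(\alpha))$ and $\alpha\mapsto d^\nabla(l(\alpha))$ on sections $\alpha\in\Gamma(A)$. *)

(* Defs.v *)
From HB Require Import structures.
From mathcomp Require Import all_boot all_order all_algebra.
From mathcomp Require Import all_classical all_reals all_analysis.
From mathcomp Require Import ring.

Set Implicit Arguments.
Unset Strict Implicit.
Unset Printing Implicit Defensive.

Import Order.TTheory GRing.Theory Num.Theory.
Import numFieldNormedType.Exports.

Local Open Scope classical_set_scope.
Local Open Scope ring_scope.

Section Euclidean.
Variables (R : realType) (n : nat).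
Implicit Types (U : set 'rV[R]_n) (f g : 'rV[R]_n -> R).

(* All iterated partial derivatives up to order [k] exist and are continuous
   on [U]; only meant for open [U]. *)
Fixpoint Ck (k : nat) U f : Prop :=
  (forall x, U x -> {for x, continuous f}) /\
  match k with
  | 0 => True
  | k'.+1 => forall i : 'I_n,
      (forall x, U x -> derivable f x (delta_mx 0 i)) /\
      Ck k' U (fun x => 'D_(delta_mx 0 i) f x)
  end.

Definition smooth_on U f := forall k, Ck k U f.

Lemma Ck_eq k U f g : open U -> (forall x, U x -> f x = g x) ->
  Ck k U f -> Ck k U g.
Proof.
move=> oU; elim: k f g => [|k IH] f g fg /= [cf df].
- have near_fg x : U x -> \forall y \near x, f y = g y.
    by move=> Ux; apply: filterS (open_nbhs_nbhs (conj oU Ux)) => y /fg.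
  split => // x Ux; apply: cvg_trans (near_eq_cvg (near_fg x Ux)) _.
  by rewrite -(fg x Ux); exact: cf.
- have near_fg x : U x -> \forall y \near x, f y = g y.
    by move=> Ux; apply: filterS (open_nbhs_nbhs (conj oU Ux)) => y /fg.
  split.
    move=> x Ux; apply: cvg_trans (near_eq_cvg (near_fg x Ux)) _.
    by rewrite -(fg x Ux); exact: cf.
  move=> i; have [d1 d2] := df i; split.
    by move=> x Ux; apply: near_eq_derivable (d1 x Ux); exact: near_fg.
  by apply: IH d2 => x Ux; apply: near_eq_derive; exact: near_fg.
Qed.

Lemma CkS k U f : Ck k.+1 U f -> Ck k U f.
Proof.
elim: k f => [|k IH] f; first by case.
move=> [cf df]; split => // i; have [d1 d2] := df i.
by split => //; exact: IH.
Qed.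

Lemma Ck_cst k U c : Ck k U (fun=> c).
Proof.
have cc (a : R) (x : 'rV[R]_n) : {for x, continuous (fun=> a)}.
  exact: cst_continuous.
elim: k c => [|k IH] c; first by split.
split; first by move=> x _; exact: cc.
move=> i; split; first by move=> x _; exact: derivable_cst.
have -> : (fun x => 'D_(delta_mx 0 i) (fun=> c) x) = (fun _ : 'rV[R]_n => 0 : R).
  by rewrite funeqE => x; exact: derive_cst.
exact: IH.
Qed.

Lemma CkD k U f g : open U -> Ck k U f -> Ck k U g ->
  Ck k U (fun x => f x + g x).
Proof.
move=> oU; elim: k f g => [|k IH] f g [cf df] [cg dg].
  by split => // x Ux; exact: continuousD (cf x Ux) (cg x Ux).
split; first by move=> x Ux; exact: continuousD (cf x Ux) (cg x Ux).
move=> i; have [f1 f2] := df i; have [g1 g2] := dg i; split.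
  by move=> x Ux; apply: derivableD; [exact: f1|exact: g1].
apply: Ck_eq (IH _ _ f2 g2) => // x Ux.
by rewrite -deriveD; [|exact: f1|exact: g1].
Qed.

Lemma CkM k U f g : open U -> Ck k U f -> Ck k U g ->
  Ck k U (fun x => f x * g x).
Proof.
move=> oU; elim: k f g => [|k IH] f g Cf Cg.
  case: Cf => cf _; case: Cg => cg _.
  by split => // x Ux; exact: continuousM (cf x Ux) (cg x Ux).
have Cf' := CkS Cf; have Cg' := CkS Cg.
case: Cf => cf df; case: Cg => cg dg.
split; first by move=> x Ux; exact: continuousM (cf x Ux) (cg x Ux).
move=> i; have [f1 f2] := df i; have [g1 g2] := dg i; split.
  by move=> x Ux; apply: derivableM; [exact: f1|exact: g1].
apply: Ck_eq (CkD oU (IH _ _ Cf' g2) (IH _ _ Cg' f2)) => // x Ux.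
by rewrite -[RHS]/('D_(delta_mx 0 i) (f * g) x) deriveM; [|exact: f1|exact: g1].
Qed.

End Euclidean.

(* Hausdorff, second countable, with a smooth (not necessarily maximal)
   atlas.  The chart [c] is the homeomorphism [chart c] from [chart_dom c] onto
   its open image, with inverse [chart_inv c]; the values of [chart c] and
   [chart_inv c] outside these sets are irrelevant. *)
Record manifold (R : realType) := Manifold {
  mdim : nat;
  points :> topologicalType;
  points_hausdorff : hausdorff_space points;
  points_second_countable : @second_countable points;
  chart_index : Type;
  chart_dom : chart_index -> set points;
  chart : chart_index -> points -> 'rV[R]_mdim;
  chart_inv : chart_index -> 'rV[R]_mdim -> points;
  chart_dom_open : forall c, open (chart_dom c);
  chart_cover : forall x, exists c, chart_dom c x;
  chart_image_open : forall c, open (chart c @` chart_dom c);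
  chartK : forall c x, chart_dom c x -> chart_inv c (chart c x) = x;
  chart_continuous : forall c x, chart_dom c x -> {for x, continuous (chart c)};
  chart_inv_continuous : forall c y, (chart c @` chart_dom c) y ->
    {for y, continuous (chart_inv c)};
  chart_transition : forall c c' (i : 'I_mdim),
    smooth_on (chart c @` (chart_dom c `&` chart_dom c'))
              (fun y => chart c' (chart_inv c y) 0 i) }.

(* Only meant for open [W]. *)
Definition smooth_in (R : realType) (M : manifold R) (W : set M) (f : M -> R) :=
  forall c, smooth_on (chart c @` (chart_dom c `&` W)) (f \o chart_inv c).

Section SmoothIn.
Variables (R : realType) (M : manifold R) (W : set M).
Hypothesis oW : open W.
Implicit Types f g : M -> R.

Lemma chart_image_openI (c : chart_index M) :
  open (chart c @` (chart_dom c `&` W)).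
Proof.
rewrite openE => _ [x [Dx Wx] <-].
have Uy : (chart c @` chart_dom c) (chart c x) by exists x.
have oU := @chart_image_open _ M c.
have n1 : nbhs (chart c x) (chart c @` chart_dom c) by exact: open_nbhs_nbhs.
have n2 : nbhs (chart c x) (chart_inv c @^-1` W).
  apply: (chart_inv_continuous Uy); rewrite chartK //.
  exact: open_nbhs_nbhs.
rewrite /interior /=; apply: filterS2 n1 n2 => _ [z Dz <-] /=.
by rewrite chartK // => Wz; exists z.
Qed.

Lemma smooth_in_eq f g : (forall x, W x -> f x = g x) ->
  smooth_in W f -> smooth_in W g.
Proof.
move=> fg sf c k; apply: Ck_eq (sf c k); first exact: chart_image_openI.
by move=> _ [x [Dx Wx] <-] /=; rewrite chartK // fg.
Qed.

Lemma smooth_in_cst a : smooth_in W (fun=> a).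
Proof. by move=> c k; exact: Ck_cst. Qed.

Lemma smooth_inD f g : smooth_in W f -> smooth_in W g ->
  smooth_in W (fun x => f x + g x).
Proof.
by move=> sf sg c k; apply: CkD; [exact: chart_image_openI|exact: sf|exact: sg].
Qed.

Lemma smooth_inM f g : smooth_in W f -> smooth_in W g ->
  smooth_in W (fun x => f x * g x).
Proof.
by move=> sf sg c k; apply: CkM; [exact: chart_image_openI|exact: sf|exact: sg].
Qed.

End SmoothIn.

Lemma smooth_inW (R : realType) (M : manifold R) (W : set M) (f : M -> R) :
  open W -> smooth_in setT f -> smooth_in W f.
Proof.
move=> oW sf c k; elim: k (f \o _) (sf c k) => [|k IH] g /= [cg dg].
  by split => // _ [x [Dx Wx] <-]; apply: cg; exists x.
split; first by move=> _ [x [Dx Wx] <-]; apply: cg; exists x.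
move=> i; have [d1 d2] := dg i; split; last exact: IH.
by move=> _ [x [Dx Wx] <-]; apply: d1; exists x.
Qed.

Record smooth_fun (R : realType) (M : manifold R) := SmoothFun {
  sfun :> M -> R;
  sfunP : smooth_in setT sfun }.

Notation "C^oo( M )" := (smooth_fun M) (at level 8, format "C^oo( M )").

Section SmoothFunRing.
Variables (R : realType) (M : manifold R).
Implicit Types f g h : C^oo(M).

Lemma sfunE f g : (forall x, f x = g x) -> f = g.
Proof.
case: f g => [f Pf] [g Pg] /= /funext fg; subst g.
by congr SmoothFun; exact: Prop_irrelevance.
Qed.

HB.instance Definition _ := gen_eqMixin (C^oo(M)).
HB.instance Definition _ := gen_choiceMixin (C^oo(M)).

Definition sfun_cst (a : R) : C^oo(M) := SmoothFun (smooth_in_cst setT a).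
Definition sfun_add f g : C^oo(M) :=
  SmoothFun (smooth_inD openT (@sfunP _ _ f) (@sfunP _ _ g)).
Definition sfun_mul f g : C^oo(M) :=
  SmoothFun (smooth_inM openT (@sfunP _ _ f) (@sfunP _ _ g)).
Definition sfun_opp f := sfun_mul (sfun_cst (-1)) f.

Let addA : associative sfun_add.
Proof. by move=> f g h; apply: sfunE => x /=; rewrite addrA. Qed.
Let addC : commutative sfun_add.
Proof. by move=> f g; apply: sfunE => x /=; rewrite addrC. Qed.
Let add0 : left_id (sfun_cst 0) sfun_add.
Proof. by move=> f; apply: sfunE => x /=; rewrite add0r. Qed.
Let addN : left_inverse (sfun_cst 0) sfun_opp sfun_add.
Proof. by move=> f; apply: sfunE => x /=; rewrite mulN1r addNr. Qed.
HB.instance Definition _ :=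
  GRing.isZmodule.Build (C^oo(M)) addA addC add0 addN.

Let mulA : associative sfun_mul.
Proof. by move=> f g h; apply: sfunE => x /=; rewrite mulrA. Qed.
Let mulC : commutative sfun_mul.
Proof. by move=> f g; apply: sfunE => x /=; rewrite mulrC. Qed.
Let mul1 : left_id (sfun_cst 1) sfun_mul.
Proof. by move=> f; apply: sfunE => x /=; rewrite mul1r. Qed.
Let mulD : left_distributive sfun_mul sfun_add.
Proof. by move=> f g h; apply: sfunE => x /=; rewrite mulrDl. Qed.
HB.instance Definition _ :=
  GRing.Zmodule_isComPzRing.Build (C^oo(M)) mulA mulC mul1 mulD.

End SmoothFunRing.

Arguments sfun_cst {R M} a.

Section Tangent.
Variables (R : realType) (M : manifold R) (x : M).

(* T_x M, as the space of derivations at [x] of the algebra C^oo(M). *)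
Record tangent := Tangent {
  tan :> C^oo(M) -> R;
  tan_linear : forall (a : R) (f g : C^oo(M)),
    tan (sfun_cst a * f + g) = a * tan f + tan g;
  tan_leibniz : forall f g : C^oo(M), tan (f * g) = f x * tan g + g x * tan f }.
Implicit Types u v w : tangent.

Lemma tanE u v : (forall f, u f = v f) -> u = v.
Proof.
case: u v => [u u1 u2] [v v1 v2] /= /funext uv; subst v.
by congr Tangent; exact: Prop_irrelevance.
Qed.

HB.instance Definition _ := gen_eqMixin tangent.
HB.instance Definition _ := gen_choiceMixin tangent.

Program Definition tan0 : tangent := @Tangent (fun=> 0) _ _.
Next Obligation. by move=> a f g /=; rewrite mulr0 addr0. Qed.
Next Obligation. by move=> f g /=; rewrite !mulr0 addr0. Qed.

Program Definition tan_add u v : tangent := @Tangent (fun f => u f + v f) _ _.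
Next Obligation. by move=> u v a f g /=; rewrite !tan_linear mulrDr addrACA. Qed.
Next Obligation. by move=> u v f g /=; rewrite !tan_leibniz !mulrDr addrACA. Qed.

Program Definition tan_scale (a : R) u : tangent :=
  @Tangent (fun f => a * u f) _ _.
Next Obligation. by move=> a u b f g /=; rewrite tan_linear mulrDr mulrCA. Qed.
Next Obligation. by move=> a u f g /=; rewrite tan_leibniz mulrDr !(mulrCA a). Qed.

Definition tan_opp u := tan_scale (-1) u.

Let addA : associative tan_add.
Proof. by move=> u v w; apply: tanE => f /=; rewrite addrA. Qed.
Let addC : commutative tan_add.
Proof. by move=> u v; apply: tanE => f /=; rewrite addrC. Qed.
Let add0 : left_id tan0 tan_add.
Proof. by move=> u; apply: tanE => f /=; rewrite add0r. Qed.
Let addN : left_inverse tan0 tan_opp tan_add.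
Proof. by move=> u; apply: tanE => f /=; rewrite mulN1r addNr. Qed.
HB.instance Definition _ := GRing.isZmodule.Build tangent addA addC add0 addN.

Let scaleA a b v : tan_scale a (tan_scale b v) = tan_scale (a * b) v.
Proof. by apply: tanE => f /=; rewrite mulrA. Qed.
Let scale1 : left_id 1 tan_scale.
Proof. by move=> v; apply: tanE => f /=; rewrite mul1r. Qed.
Let scaleDr : right_distributive tan_scale +%R.
Proof. by move=> a u v; apply: tanE => f /=; rewrite mulrDr. Qed.
Let scaleDl v : {morph tan_scale^~ v : a b / a + b}.
Proof. by move=> a b; apply: tanE => f /=; rewrite mulrDl. Qed.
HB.instance Definition _ := GRing.Zmodule_isLmodule.Build R tangent
  scaleA scale1 scaleDr scaleDl.

End Tangent.

(* What TM and vector bundles have in common: vector spaces over the points of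
   [M] and a C^oo(M)-module of sections declared smooth. *)
Record bundle (R : realType) (M : manifold R) := Bundle {
  fiber :> M -> lmodType R;
  smooth_section : (forall x, fiber x) -> Prop;
  smooth_section0 : smooth_section (fun=> 0);
  smooth_sectionD : forall s t, smooth_section s -> smooth_section t ->
    smooth_section (fun x => s x + t x);
  smooth_sectionZ : forall (f : C^oo(M)) s, smooth_section s ->
    smooth_section (fun x => f x *: s x) }.

Record section (R : realType) (M : manifold R) (E : bundle M) := Section {
  sect :> forall x, E x;
  sectP : smooth_section sect }.

Notation "'Gamma' E" := (section E) (at level 10, E at level 9).

Section SectionModule.
Variables (R : realType) (M : manifold R) (E : bundle M).
Implicit Types s t : Gamma E.

Lemma sectE s t : (forall x, s x = t x) -> s = t.
Proof.
case: s t => [s Ps] [t Pt] /= st.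
have {}st : s = t by exact: functional_extensionality_dep.
by subst t; congr Section; exact: Prop_irrelevance.
Qed.

HB.instance Definition _ := gen_eqMixin (Gamma E).
HB.instance Definition _ := gen_choiceMixin (Gamma E).

Definition sect0 : Gamma E := Section (smooth_section0 E).
Definition sect_add s t : Gamma E := Section (smooth_sectionD (sectP s) (sectP t)).
Definition sect_scale (f : C^oo(M)) s : Gamma E :=
  Section (smooth_sectionZ f (sectP s)).
Definition sect_opp s := sect_scale (sfun_cst (-1)) s.

Let addA : associative sect_add.
Proof. by move=> s t u; apply: sectE => x /=; rewrite addrA. Qed.
Let addC : commutative sect_add.
Proof. by move=> s t; apply: sectE => x /=; rewrite addrC. Qed.
Let add0 : left_id sect0 sect_add.
Proof. by move=> s; apply: sectE => x /=; rewrite add0r. Qed.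
Let addN : left_inverse sect0 sect_opp sect_add.
Proof. by move=> s; apply: sectE => x /=; rewrite scaleN1r addNr. Qed.
HB.instance Definition _ := GRing.isZmodule.Build (Gamma E) addA addC add0 addN.

Let scaleA f g s : sect_scale f (sect_scale g s) = sect_scale (f * g) s.
Proof. by apply: sectE => x /=; rewrite scalerA. Qed.
Let scale1 : left_id 1 sect_scale.
Proof. by move=> s; apply: sectE => x /=; rewrite scale1r. Qed.
Let scaleDr : right_distributive sect_scale +%R.
Proof. by move=> f s t; apply: sectE => x /=; rewrite scalerDr. Qed.
Let scaleDl s : {morph sect_scale^~ s : f g / f + g}.
Proof. by move=> f g; apply: sectE => x /=; rewrite scalerDl. Qed.
HB.instance Definition _ := GRing.Zmodule_isLmodule.Build (C^oo(M)) (Gamma E)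
  scaleA scale1 scaleDr scaleDl.

End SectionModule.

Section TangentBundle.
Variables (R : realType) (M : manifold R).

Program Definition TM : bundle M := @Bundle R M (fun x => tangent x)
  (fun X => forall f : C^oo(M), smooth_in setT (fun x => X x f)) _ _ _.
Next Obligation. by move=> f; exact: smooth_in_cst. Qed.
Next Obligation.
by move=> X Y sX sY f; exact: (smooth_inD openT (sX f) (sY f)).
Qed.
Next Obligation.
by move=> g X sX f; exact: (smooth_inM openT (@sfunP _ _ g) (sX f)).
Qed.

Implicit Types X Y : Gamma TM.

Definition vf_app X (f : C^oo(M)) : C^oo(M) := SmoothFun (sectP X f).

Lemma vf_app_linear X (a : R) f g :
  vf_app X (sfun_cst a * f + g) = sfun_cst a * vf_app X f + vf_app X g.
Proof. by apply: sfunE => x; exact: tan_linear. Qed.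

Lemma vf_app_leibniz X f g : vf_app X (f * g) = f * vf_app X g + g * vf_app X f.
Proof. by apply: sfunE => x; exact: tan_leibniz. Qed.

Program Definition lie_at X Y (x : M) : tangent x :=
  @Tangent R M x (fun f => X x (vf_app Y f) - Y x (vf_app X f)) _ _.
Next Obligation.
move=> X Y x a f g /=.
by rewrite !vf_app_linear !tan_linear opprD addrACA mulrBr.
Qed.
Next Obligation.
move=> X Y x f g /=.
have tanD (u : tangent x) p q : u (p + q) = u p + u q.
  have -> : p + q = sfun_cst 1 * p + q by apply: sfunE => y /=; rewrite mul1r.
  by rewrite tan_linear mul1r.
rewrite !vf_app_leibniz !tanD !tan_leibniz /=; ring.
Qed.

Program Definition lie X Y : Gamma TM := @Section R M TM (lie_at X Y) _.
Next Obligation.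
move=> X Y f; apply: smooth_in_eq
  (@sfunP _ _ (vf_app X (vf_app Y f) - vf_app Y (vf_app X f))) => //.
- exact: openT.
- by move=> x _ /=; rewrite mulN1r.
Qed.

End TangentBundle.

(* A real vector bundle of rank [rk], given by its fibres and by local
   trivialisations over an open cover whose transition functions are smooth
   (which determines the smooth structure on the total space). [triv_inv j x]
   is only meaningful for [x] in [triv_dom j]. *)
Record vector_bundle (R : realType) (M : manifold R) := VectorBundle {
  vb_fiber : M -> lmodType R;
  rk : nat;
  triv_index : Type;
  triv_dom : triv_index -> set M;
  triv : triv_index -> forall x, {linear vb_fiber x -> 'rV[R]_rk};
  triv_inv : triv_index -> forall x, 'rV[R]_rk -> vb_fiber x;
  triv_dom_open : forall j, open (triv_dom j);
  triv_cover : forall x, exists j, triv_dom j x;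
  trivK : forall j x, triv_dom j x -> cancel (triv j x) (triv_inv j x);
  triv_invK : forall j x, triv_dom j x -> cancel (triv_inv j x) (triv j x);
  triv_transition : forall j j' (a b : 'I_rk),
    smooth_in (triv_dom j `&` triv_dom j')
      (fun x => triv j' x (triv_inv j x (delta_mx 0 a)) 0 b) }.

Program Definition bundle_of (R : realType) (M : manifold R)
    (E : vector_bundle M) : bundle M :=
  @Bundle R M (@vb_fiber R M E)
    (fun s => forall (j : triv_index E) (b : 'I_(rk E)),
       smooth_in (triv_dom j) (fun x => triv j x (s x) 0 b)) _ _ _.
Next Obligation.
move=> R M E j b; apply: smooth_in_eq (@smooth_in_cst _ _ _ 0); first exact: triv_dom_open.
by move=> x _; rewrite linear0 mxE.
Qed.
Next Obligation.
move=> R M E s t ss st j b.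
apply: smooth_in_eq (smooth_inD (triv_dom_open j) (ss j b) (st j b)).
  exact: triv_dom_open.
by move=> x _; rewrite linearD mxE.
Qed.
Next Obligation.
move=> R M E f s ss j b; have oj := triv_dom_open j.
apply: smooth_in_eq (smooth_inM oj (smooth_inW oj (@sfunP _ _ f)) (ss j b)) => //.
by move=> x _; rewrite linearZ mxE.
Qed.

Coercion bundle_of : vector_bundle >-> bundle.

(* That the anchor intertwines the brackets follows from these axioms. *)
Record lie_algebroid (R : realType) (M : manifold R) := LieAlgebroid {
  la_bundle :> vector_bundle M;
  anchor : forall x, {linear la_bundle x -> tangent x};
  anchor_smooth : forall a : Gamma la_bundle,
    @smooth_section R M (TM M) (fun x => anchor x (a x));
  bracket : Gamma la_bundle -> Gamma la_bundle -> Gamma la_bundle;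
  bracket_linear : forall (c : R) a b d,
    bracket (sfun_cst c *: a + b) d = sfun_cst c *: bracket a d + bracket b d;
  bracket_antisym : forall a b, bracket a b = - bracket b a;
  bracket_jacobi : forall a b d,
    bracket a (bracket b d) + bracket b (bracket d a)
      + bracket d (bracket a b) = 0;
  bracket_leibniz : forall a (f : C^oo(M)) b,
    bracket a (f *: b)
      = f *: bracket a b
        + @vf_app R M (Section (anchor_smooth a)) f *: b }.

Definition rho (R : realType) (M : manifold R) (A : lie_algebroid M)
  (a : Gamma A) : Gamma (TM M) := Section (anchor_smooth a).

Section Connections.
Variables (R : realType) (M : manifold R).

(* For a bundle [E] with fibrewise map [anc] to TM: covers both A-connections
   and usual linear connections. *)
Record connection (E : bundle M) (anc : forall x, E x -> tangent x)
    (V : vector_bundle M) := Connection {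
  nabla_at : forall x, E x -> Gamma V -> V x;
  nabla_linear_l : forall x (c : R) (e e' : E x) s,
    nabla_at (c *: e + e') s = c *: nabla_at e s + nabla_at e' s;
  nabla_linear_r : forall x (e : E x) (c : R) s t,
    nabla_at e (sfun_cst c *: s + t) = c *: nabla_at e s + nabla_at e t;
  nabla_leibniz : forall x (e : E x) (f : C^oo(M)) s,
    nabla_at e (f *: s) = f x *: nabla_at e s + anc x e f *: s x;
  nabla_smooth : forall (a : Gamma E) s,
    @smooth_section R M V (fun x => nabla_at (a x) s) }.

Definition nabla E anc V (D : @connection E anc V) (a : Gamma E) (s : Gamma V) :
  Gamma V := Section (nabla_smooth D a s).

Definition curvature E anc V (br : Gamma E -> Gamma E -> Gamma E)
    (D : @connection E anc V) (a b : Gamma E) (s : Gamma V) : Gamma V :=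
  nabla D a (nabla D b s) - nabla D b (nabla D a s) - nabla D (br a b) s.

Definition linear_connection (V : vector_bundle M) :=
  @connection (TM M) (fun _ v => v) V.

Definition flat V (D : linear_connection V) : Prop :=
  forall X Y s, curvature (@lie R M) D X Y s = 0.

Record representation (A : lie_algebroid M) (V : vector_bundle M) :=
  Representation {
    rep_conn :> connection (@anchor R M A) V;
    rep_flat : forall a b s, curvature (@bracket R M A) rep_conn a b s = 0 }.

(* The curvature at the tangent vectors [anchor A x a] and [v] is evaluated on
   vector fields [X], [Y] extending them. *)
Definition A_invariant A V (DA : representation A V) (D : linear_connection V) :=
  (forall x (a : A x) s, nabla_at DA a s = @nabla_at _ _ _ D x (anchor A x a) s)
  /\ (forall x (a : A x) (v : tangent x) (X Y : Gamma (TM M)),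
        X x = anchor A x a -> Y x = v ->
        forall s, curvature (@lie R M) D X Y s x = 0).

End Connections.

(* Forms are alternating C^oo(M)-multilinear maps on vector fields. To treat
   all degrees uniformly, a form takes the finite sequence of its arguments and
   vanishes on sequences of the wrong length; hence there are no nonzero forms
   of negative degree, so Omega^(k-1) makes sense for k = 0. *)
Definition preform (R : realType) (M : manifold R) (V : vector_bundle M) : Type :=
  seq (Gamma (TM M)) -> Gamma V.

Section Forms.
Variables (R : realType) (M : manifold R) (V : vector_bundle M).
Implicit Types (X Y : Gamma (TM M)) (s t : seq (Gamma (TM M))).
Implicit Types (f : C^oo(M)) (w : preform V).

Record is_form (d : int) w : Prop := IsForm {
  form_degree : forall s, (size s)%:Z != d -> w s = 0;
  form_linear : forall s t f X Y,
    w (s ++ (f *: X + Y) :: t) = f *: w (s ++ X :: t) + w (s ++ Y :: t);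
  form_alternating : forall X s t u, w (s ++ X :: t ++ X :: u) = 0 }.

Definition Omega (d : int) : set (preform V) := [set w | is_form d w].

Definition drop_at (i : nat) s := take i s ++ drop i.+1 s.

Definition contract X w : preform V := fun s => w (X :: s).

(* The wedge product df /\ w. *)
Definition dwedge f w : preform V := fun s =>
  \sum_(i < size s) (-1) ^+ i *: (vf_app s`_i f *: w (drop_at i s)).

(* The covariant exterior derivative, by Koszul's formula. *)
Definition dnabla (D : linear_connection V) w : preform V := fun s =>
  \sum_(i < size s) (-1) ^+ i *: nabla D s`_i (w (drop_at i s))
  + \sum_(j < size s) \sum_(i < j)
      (-1) ^+ (i + j)%N *: w (lie s`_i s`_j :: drop_at i (drop_at j s)).

Definition Lie (A : lie_algebroid M) (DA : representation A V) (a : Gamma A) w :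
    preform V := fun s =>
  nabla DA a (w s) - \sum_(i < size s) w (set_nth 0 s i (lie (rho a) s`_i)).

End Forms.

Arguments Omega {R M} V d.

Section IM.
Variables (R : realType) (M : manifold R).
Variables (A : lie_algebroid M) (V : vector_bundle M).

Definition IM_pair : Type := (Gamma A -> preform V) * (Gamma A -> preform V).

(* The bundle map [l] is given by the C^oo(M)-linear map it induces on
   sections. *)
Record is_IM_form (DA : representation A V) (k : nat) (Ll : IM_pair) : Prop :=
  IsIMForm {
    IM_L_form : forall a, Omega V k%:Z (Ll.1 a);
    IM_L_linear : forall (c : R) a b,
      Ll.1 (sfun_cst c *: a + b) = sfun_cst c *: Ll.1 a + Ll.1 b;
    IM_l_form : forall a, Omega V (k%:Z - 1) (Ll.2 a);
    IM_l_linear : forall (f : C^oo(M)) a b,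
      Ll.2 (f *: a + b) = f *: Ll.2 a + Ll.2 b;
    IM_leibniz : forall (f : C^oo(M)) a,
      Ll.1 (f *: a) = f *: Ll.1 a + dwedge f (Ll.2 a);
    IM_contract : forall a b,
      contract (rho a) (Ll.2 b) = - contract (rho b) (Ll.2 a);
    IM_bracket_L : forall a b,
      Ll.1 (bracket a b) = Lie DA a (Ll.1 b) - Lie DA b (Ll.1 a);
    IM_bracket_l : forall a b,
      Ll.2 (bracket a b) = Lie DA a (Ll.2 b) - contract (rho b) (Ll.1 a) }.

Definition Omega_IM (DA : representation A V) (k : nat) : set IM_pair :=
  [set Ll | is_IM_form DA k Ll].

Definition d_IM (D : linear_connection V) (Ll : IM_pair) : IM_pair :=
  (fun a => dnabla D (Ll.1 a), fun a => Ll.1 a - dnabla D (Ll.2 a)).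

End IM.

(* Main.v *)
From mathcomp Require Import all_boot all_order all_algebra.
From mathcomp Require Import all_classical all_reals all_analysis.
From mathcomp Require Import ring.
Require Import Defs.

(** All identities are proved on a list of arguments, by induction on its
    length: Koszul's formula is only used to derive Cartan's formula
    [i_X d w = L_X w - d (i_X w)], which together with
    [i_Y (L_X w) = L_X (i_Y w) - i_[X,Y] w] reduces every identity to a shorter
    list.  Here [L_X w (X_1, .., X_k)] is [nabla_X (w (X_1, .., X_k))] minus the
    terms [w (.., [X, X_i], ..)].  If [R(X, Y) = 0] then [[L_X, L_Y] = L_[X,Y]],
    hence [L_X d = d L_X] if [R(X, Y) = 0] for every [Y]; the latter gives
    [d d = 0] if [nabla] is flat.  Invariance says that the Lie derivative along
    a section [a] of [A] is [L_(rho a)] and that it commutes with [d], and the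
    axioms for [(d L, L - d l)] follow formally from those for [(L, l)]. *)

Set Implicit Arguments.
Unset Strict Implicit.
Unset Printing Implicit Defensive.

Import GRing.Theory.

Local Open Scope classical_set_scope.
Local Open Scope ring_scope.

(** * Vector fields and their Lie bracket *)

Section VectorFields.
Variables (R : realType) (M : manifold R).
Implicit Types (f g : C^oo(M)) (X Y Z : Gamma (TM M)).

Lemma tanD (x : M) (u : tangent x) f g : u (f + g) = u f + u g.
Proof.
have -> : f + g = sfun_cst 1 * f + g by apply: sfunE => y /=; rewrite mul1r.
by rewrite tan_linear mul1r.
Qed.

Lemma vf_appE X f x : vf_app X f x = X x f. Proof. by []. Qed.

Lemma vf_appD_l X Y f : vf_app (X + Y) f = vf_app X f + vf_app Y f.
Proof. exact: sfunE. Qed.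

Lemma vf_appZ_l g X f : vf_app (g *: X) f = g * vf_app X f.
Proof. exact: sfunE. Qed.

Lemma vf_app_lie X Y f :
  vf_app (lie X Y) f = vf_app X (vf_app Y f) - vf_app Y (vf_app X f).
Proof. by apply: sfunE => x /=; rewrite mulN1r. Qed.

(** Reduces bracket identities to identities between functions, where the bracket is a commutator of
    derivations. *)
Lemma vf_ext X Y : (forall f, vf_app X f = vf_app Y f) -> X = Y.
Proof.
move=> XY; apply: sectE => x; apply: tanE => f.
by rewrite -!vf_appE XY.
Qed.

Lemma vf_appN_l X f : vf_app (- X) f = - vf_app X f.
Proof. by apply/eqP; rewrite -addr_eq0 -vf_appD_l addNr; apply/eqP/sfunE. Qed.

Lemma vf_appD X f g : vf_app X (f + g) = vf_app X f + vf_app X g.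
Proof. by apply: sfunE => x; exact: tanD. Qed.

Lemma vf_appB X f g : vf_app X (f - g) = vf_app X f - vf_app X g.
Proof. by apply/eqP; rewrite eq_sym subr_eq -vf_appD subrK. Qed.

Lemma lieDr X Y Z : lie X (Y + Z) = lie X Y + lie X Z.
Proof.
apply: vf_ext => f; rewrite !(vf_app_lie, vf_appD_l, vf_appD); ring.
Qed.

Lemma lieZr X f Y : lie X (f *: Y) = f *: lie X Y + vf_app X f *: Y.
Proof.
apply: vf_ext => g.
rewrite !(vf_app_lie, vf_appZ_l, vf_appD_l, vf_app_leibniz); ring.
Qed.

Lemma lieC X Y : lie X Y = - lie Y X.
Proof. by apply: vf_ext => f; rewrite vf_appN_l !vf_app_lie opprB. Qed.

Lemma lieDl X Y Z : lie (X + Y) Z = lie X Z + lie Y Z.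
Proof. by rewrite lieC lieDr opprD -!lieC. Qed.

Lemma lieZl f X Y : lie (f *: X) Y = f *: lie X Y - vf_app Y f *: X.
Proof. by rewrite lieC lieZr opprD -scalerN -lieC. Qed.

Lemma liexx X : lie X X = 0.
Proof. by apply: vf_ext => f; rewrite vf_app_lie subrr; apply: sfunE. Qed.

Lemma lie_jacobi X Y Z : lie (lie X Y) Z = lie X (lie Y Z) - lie Y (lie X Z).
Proof.
apply: vf_ext => f; rewrite !(vf_app_lie, vf_appD_l, vf_appN_l, vf_appB); ring.
Qed.

End VectorFields.

(** * Linear connections on sections *)

Section Connection.
Variables (R : realType) (M : manifold R) (V : vector_bundle M).
Variable D : linear_connection V.
Implicit Types (f : C^oo(M)) (X Y : Gamma (TM M)) (s t : Gamma V).

Lemma nablaD_l X Y s : nabla D (X + Y) s = nabla D X s + nabla D Y s.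
Proof.
apply: sectE => x /=.
by have := nabla_linear_l D 1 (X x) (Y x) s; rewrite !scale1r.
Qed.

Lemma nablaZ_l f X s : nabla D (f *: X) s = f *: nabla D X s.
Proof.
apply: sectE => x /=; have := nabla_linear_l D (f x) (X x) 0 s.
(* Linearity with coefficient 1 and both vectors 0 forces the value at the zero vector to vanish. *)
have := nabla_linear_l D 1 (0 : tangent x) 0 s.
rewrite !scale1r !addr0 => /eqP; rewrite -subr_eq0 opprD addNKr oppr_eq0.
by move=> /eqP ->; rewrite addr0.
Qed.

Lemma nablaD X s t : nabla D X (s + t) = nabla D X s + nabla D X t.
Proof.
apply: sectE => x /=; have := nabla_linear_r D (X x) 1 s t.
by rewrite (_ : sfun_cst 1 = 1) // !scale1r.
Qed.

Lemma nabla0 X : nabla D X 0 = 0.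
Proof. by apply: (addrI (nabla D X 0)); rewrite -nablaD !addr0. Qed.

Lemma nablaZ X f s : nabla D X (f *: s) = f *: nabla D X s + vf_app X f *: s.
Proof. by apply: sectE => x; exact: nabla_leibniz. Qed.

End Connection.

(* Decides equalities between signed sums in a [zmodType] by moving every term
   to one side and cancelling the opposite ones. *)
Ltac zmod_cancel :=
  apply/eqP; rewrite -subr_eq0 ?(opprD, opprK, oppr0);
  match goal with |- is_true (?E == 0) => rewrite -[E]add0r end;
  rewrite ?(addrA, addr0);
  repeat match goal with
  | |- is_true (_ + ?u + - ?u == 0) => rewrite (addrK u)
  | |- is_true (_ + - ?u + ?u == 0) => rewrite (subrK u)
  | |- is_true (_ + - ?u == 0) => rewrite [_ + u + _]addrAC
  | |- is_true (_ + ?u == 0) => rewrite [_ + - u + _]addrAC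
  end; exact: eqxx.

(** * Alternating forms, contraction and the wedge with [df] *)

Section AlternatingForms.
Variables (R : realType) (M : manifold R) (V : vector_bundle M).
Implicit Types (f g : C^oo(M)) (X Y Z : Gamma (TM M)).
Implicit Types (s t u : seq (Gamma (TM M))) (v w : preform V).

(* Forms of no definite degree, i.e. formal sums of forms: the identities of the
   Cartan calculus do not involve the degree. *)
Lemma preformD v w s : (v + w) s = v s + w s. Proof. by []. Qed.
Lemma preformN w s : (- w) s = - w s. Proof. by []. Qed.
Lemma preformZ f w s : (f *: w) s = f *: w s. Proof. by []. Qed.
Definition preformE := (preformD, preformN, preformZ).

Definition alt_form w : Prop :=
  (forall s t f X Y,
    w (s ++ (f *: X + Y) :: t) = f *: w (s ++ X :: t) + w (s ++ Y :: t)) /\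
  (forall X s t u, w (s ++ X :: t ++ X :: u) = 0).

Lemma alt_form_lincons w f X Y s : alt_form w ->
  w ((f *: X + Y) :: s) = f *: w (X :: s) + w (Y :: s).
Proof. by case=> lw _; exact: (lw [::]). Qed.

Lemma alt_formD w s t X Y : alt_form w ->
  w (s ++ (X + Y) :: t) = w (s ++ X :: t) + w (s ++ Y :: t).
Proof. by case=> lw _; have := lw s t 1 X Y; rewrite !scale1r. Qed.

Lemma alt_form0 w s t : alt_form w -> w (s ++ 0 :: t) = 0.
Proof.
move=> aw; apply: (addrI (w (s ++ 0 :: t))).
by rewrite -alt_formD // !addr0.
Qed.

Lemma alt_formN w s t X : alt_form w -> w (s ++ (- X) :: t) = - w (s ++ X :: t).
Proof.
by move=> aw; apply/eqP; rewrite -addr_eq0 -alt_formD // addNr alt_form0.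
Qed.

Lemma alt_formZ w s t f X : alt_form w ->
  w (s ++ (f *: X) :: t) = f *: w (s ++ X :: t).
Proof.
move=> aw; have [lw _] := aw; have := lw s t f X 0.
by rewrite alt_form0 // !addr0.
Qed.

(** Polarisation: expand [w] with [X + Y] in both slots; the two diagonal terms vanish. *)
Lemma alt_form_swap w s X Y : alt_form w ->
  w [:: X, Y & s] = - w [:: Y, X & s].
Proof.
move=> aw; have [_ zw] := aw; apply/eqP; rewrite -addr_eq0.
have := zw (X + Y) [::] [::] s; rewrite /= (@alt_formD _ [::]) //=.
rewrite (@alt_formD _ [:: X]) // (@alt_formD _ [:: Y]) //=.
rewrite (zw X [::] [::]) (zw Y [::] [::]) add0r addr0.
by move=> ->.
Qed.

Lemma contract_alt X w : alt_form w -> alt_form (contract X w).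
Proof.
case=> lw zw; split=> [s t f Y Z|Y s t u]; first exact: (lw (X :: s)).
exact: (zw Y (X :: s)).
Qed.

Lemma add_alt v w : alt_form v -> alt_form w -> alt_form (v + w).
Proof.
move=> [lv zv] [lw zw]; split=> [s t f X Y|X s t u].
  by rewrite !preformE lv lw scalerDr addrACA.
by rewrite !preformE zv zw addr0.
Qed.

Lemma scale_alt f w : alt_form w -> alt_form (f *: w).
Proof.
move=> [lw zw]; split=> [s t g X Y|X s t u].
  by rewrite !preformE lw scalerDr !scalerA mulrC.
by rewrite !preformE zw scaler0.
Qed.

Lemma opp_alt w : alt_form w -> alt_form (- w).
Proof.
move=> [lw zw]; split=> [s t g X Y|X s t u].
  by rewrite !preformE lw opprD scalerN.
by rewrite !preformE zw oppr0.
Qed.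

Lemma contract_cons2 X Y w : alt_form w ->
  contract X (contract Y w) = - contract Y (contract X w).
Proof. by move=> aw; apply: funext => s; exact: alt_form_swap. Qed.

(** [Y] passes the entries of [s] one at a time, each swap costing a sign. *)
Lemma alt_form_front w s t Y : alt_form w ->
  w (s ++ Y :: t) = (-1) ^+ size s *: w (Y :: s ++ t).
Proof.
elim: s w => [|X s IH] w aw /=; first by rewrite scale1r.
rewrite -[LHS]/(contract X w (s ++ Y :: t)) IH; last exact: contract_alt.
by rewrite /contract alt_form_swap // exprS mulN1r scaleNr scalerN.
Qed.

Lemma dwedge_nil f w : dwedge f w [::] = 0.
Proof. by rewrite /dwedge big_ord0. Qed.

Lemma dwedge_cons f w X s :
  dwedge f w (X :: s) = vf_app X f *: w s - dwedge f (contract X w) s.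
Proof.
rewrite /dwedge /= big_ord_recl /= scale1r; congr (_ *: w _ + _).
  by rewrite /drop_at /= drop0.
rewrite -sumrN; apply: eq_bigr => i _ /=.
by rewrite exprS mulN1r scaleNr.
Qed.

Lemma dwedgeD f v w : dwedge f (v + w) = dwedge f v + dwedge f w.
Proof.
apply: funext => s; rewrite preformE /dwedge -big_split.
by apply: eq_bigr => i _; rewrite !preformE !scalerDr.
Qed.

Lemma dwedgeZ f g w : dwedge f (g *: w) = g *: dwedge f w.
Proof.
apply: funext => s; rewrite preformE /dwedge scaler_sumr.
by apply: eq_bigr => i _; rewrite !preformE !scalerA; congr (_ *: _); ring.
Qed.

Lemma dwedgeN f w : dwedge f (- w) = - dwedge f w.
Proof. by rewrite -scaleN1r dwedgeZ scaleN1r. Qed.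

End AlternatingForms.

(** * Lie derivative, exterior derivative and Cartan's formula *)

Section CartanCalculus.
Variables (R : realType) (M : manifold R) (V : vector_bundle M).
Variable D : linear_connection V.
Implicit Types (f g : C^oo(M)) (X Y Z : Gamma (TM M)).
Implicit Types (s t u : seq (Gamma (TM M))) (v w : preform V).

Definition lie_args X w : preform V := fun s =>
  \sum_(i < size s) w (set_nth 0 s i (lie X s`_i)).

(* Locked, so that rewriting rules for differences do not see through it. *)
Definition lie_der X w : preform V :=
  locked (fun s => nabla D X (w s) - lie_args X w s).

Lemma lie_derE X w s : lie_der X w s = nabla D X (w s) - lie_args X w s.
Proof. by rewrite /lie_der -lock. Qed.

Lemma lie_args_nil X w : lie_args X w [::] = 0.
Proof. by rewrite /lie_args big_ord0. Qed.

Lemma lie_args_cons X w Y s :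
  lie_args X w (Y :: s) = w (lie X Y :: s) + lie_args X (contract Y w) s.
Proof. by rewrite /lie_args /= big_ord_recl. Qed.

Lemma lie_argsD X v w s :
  lie_args X (v + w) s = lie_args X v s + lie_args X w s.
Proof. by rewrite /lie_args -big_split. Qed.

Lemma lie_argsZ X f w s : lie_args X (f *: w) s = f *: lie_args X w s.
Proof. by rewrite /lie_args scaler_sumr. Qed.

(** Up to sign, these are the terms of Koszul's formula that pair [X], put in front of [s], with an
    entry of [s]. *)
Lemma lie_argsE X w s : alt_form w ->
  lie_args X w s
    = \sum_(i < size s) (-1) ^+ i *: w (lie X s`_i :: drop_at i s).
Proof.
move=> aw; apply: eq_bigr => i _.
rewrite /drop_at set_nthE ltn_ord alt_form_front //.
by rewrite size_takel // ltnW.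
Qed.

(** As [w] vanishes wherever [Y] occurs, only the term replacing this [Y] by its bracket
    survives. *)
Lemma lie_args_dup X Y w t u : (forall t u, w (t ++ Y :: u) = 0) ->
  lie_args X w (t ++ Y :: u) = w (t ++ lie X Y :: u).
Proof.
elim: t w => [|Z t IH] w w0 /=; rewrite lie_args_cons.
  rewrite [lie_args _ _ _]big1 ?addr0 // => i _; exact: (w0 [::]).
rewrite -!cat_cons w0 add0r IH // => t' u'; exact: (w0 (Z :: t')).
Qed.

Lemma lie_der_dup X Y w t u : (forall t u, w (t ++ Y :: u) = 0) ->
  lie_der X w (t ++ Y :: u) = - w (t ++ lie X Y :: u).
Proof. by move=> w0; rewrite !lie_derE lie_args_dup // w0 nabla0 add0r. Qed.

Lemma lie_der_nil X w : lie_der X w [::] = nabla D X (w [::]).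
Proof. by rewrite !lie_derE lie_args_nil subr0. Qed.

Lemma lie_der_cons X Y w s :
  lie_der X w (Y :: s) = lie_der X (contract Y w) s - contract (lie X Y) w s.
Proof. rewrite !lie_derE lie_args_cons opprD /contract; zmod_cancel. Qed.

Lemma contract_lie_der X Y w :
  contract Y (lie_der X w) = lie_der X (contract Y w) - contract (lie X Y) w.
Proof. by apply: funext => s; exact: lie_der_cons. Qed.

Lemma lie_derD X v w : lie_der X (v + w) = lie_der X v + lie_der X w.
Proof.
apply: funext => s; rewrite !(lie_derE, preformE) lie_argsD nablaD; zmod_cancel.
Qed.

Lemma lie_derZ X f w :
  lie_der X (f *: w) = f *: lie_der X w + vf_app X f *: w.
Proof.
apply: funext => s; rewrite !(lie_derE, preformE) lie_argsZ nablaZ scalerBr.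
zmod_cancel.
Qed.

Lemma lie_der0 X : lie_der X (0 : preform V) = 0.
Proof.
by apply: (addrI (lie_der X (0 : preform V))); rewrite -lie_derD !addr0.
Qed.

Lemma lie_derN X w : lie_der X (- w) = - lie_der X w.
Proof. by apply/eqP; rewrite -addr_eq0 -lie_derD addNr lie_der0. Qed.

Lemma lie_derDl X Y w : alt_form w ->
  lie_der (X + Y) w = lie_der X w + lie_der Y w.
Proof.
move=> aw; apply: funext => s; rewrite !(lie_derE, preformE) nablaD_l.
suff -> : lie_args (X + Y) w s = lie_args X w s + lie_args Y w s by zmod_cancel.
rewrite !lie_argsE // -big_split; apply: eq_bigr => i _ /=.
by rewrite lieDl (@alt_formD _ _ _ _ [::]) // scalerDr.
Qed.

(** Since [[f X, Y] = f [X, Y] - Y(f) X], the terms with [Y(f) X] add up to the wedge of [df] with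
    [i_X w]. *)
Lemma lie_derZl X f w : alt_form w ->
  lie_der (f *: X) w = f *: lie_der X w + dwedge f (contract X w).
Proof.
move=> aw; apply: funext => s; rewrite !(lie_derE, preformE) nablaZ_l scalerBr.
suff -> : lie_args (f *: X) w s
    = f *: lie_args X w s - dwedge f (contract X w) s.
  by zmod_cancel.
rewrite !lie_argsE // /dwedge scaler_sumr -sumrB; apply: eq_bigr => i _ /=.
rewrite lieZl (@alt_formD _ _ _ _ [::]) // (@alt_formN _ _ _ _ [::]) //.
rewrite !(@alt_formZ _ _ _ _ [::]) // scalerBr !scalerA; congr (_ - _).
by rewrite mulrC.
Qed.

Lemma lie_der_alt X w : alt_form w -> alt_form (lie_der X w).
Proof.
move=> aw; split=> [s t f Y Z|Y s t u].
  elim: s w aw => [|X' s IH] w aw /=; last first.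
    rewrite !lie_der_cons !IH //; last exact: contract_alt.
    have [lw _] := contract_alt (lie X X') aw.
    by rewrite lw scalerBr; zmod_cancel.
  have cE : contract (f *: Y + Z) w = f *: contract Y w + contract Z w.
    by apply: funext => s; exact: alt_form_lincons.
  (* The term [X(f) i_Y w] from differentiating [f i_Y w] cancels the one from [[X, f Y]]. *)
  rewrite !lie_der_cons cE lie_derD lie_derZ !preformE /contract.
  rewrite lieDr lieZr !(@alt_formD _ _ _ _ [::]) //.
  rewrite !(@alt_formZ _ _ _ _ [::]) //=.
  by rewrite scalerBr; zmod_cancel.
elim: s w aw => [|X' s IH] w aw /=; last first.
  rewrite !lie_der_cons !IH //; last exact: contract_alt.
  have [_ zw] := contract_alt (lie X X') aw.
  by rewrite zw subr0.
have [_ zw] := aw.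
(* [i_Y w] vanishes wherever [Y] occurs, so two terms remain, with [Y] and [[X, Y]] in exchanged
   slots; they cancel by antisymmetry. *)
rewrite lie_der_cons lie_der_dup; last exact: (zw Y [::]).
rewrite /contract -[Y :: t ++ _]cat_cons alt_form_front //.
rewrite -[lie X Y :: _]cat_cons (alt_form_front (_ :: _)) //=.
rewrite (alt_form_swap _ (lie X Y)) // !scalerN opprK.
by rewrite addrN.
Qed.

Lemma dnabla_nil w : dnabla D w [::] = 0.
Proof. by rewrite /dnabla !big_ord0 addr0. Qed.

(** Cartan's formula. The terms involving index 0, that of [X], make up [lie_der X w s]; in the
    others all indices shift by one, which gives minus Koszul's formula for [contract X w]. *)
Lemma dnabla_cons w X s : alt_form w ->
  dnabla D w (X :: s) = lie_der X w s - dnabla D (contract X w) s.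
Proof.
move=> aw; rewrite /dnabla /= !big_ord_recl /= big_ord0 add0r scale1r.
rewrite {1}/drop_at /= drop0 !lie_derE lie_argsE //.
rewrite opprD -!sumrN -!addrA; congr (_ + _).
rewrite [RHS]addrCA; congr (_ + _).
  by apply: eq_bigr => i _; rewrite exprS mulN1r scaleNr.
rewrite -big_split; apply: eq_bigr => j _ /=.
rewrite big_ord_recl /= -sumrN; congr (_ + _).
  by rewrite add0n exprS mulN1r scaleNr /drop_at /= drop0.
apply: eq_bigr => i _.
rewrite /drop_at /= /contract alt_form_swap // scalerN; congr (- (_ *: _)).
by rewrite addSn addnS !exprS !mulN1r opprK.
Qed.

Lemma contract_dnabla X w : alt_form w ->
  contract X (dnabla D w) = lie_der X w - dnabla D (contract X w).
Proof. by move=> aw; apply: funext => s; exact: dnabla_cons. Qed.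

Lemma dnablaD v w : dnabla D (v + w) = dnabla D v + dnabla D w.
Proof.
apply: funext => s; rewrite preformE /dnabla addrACA.
congr (_ + _); rewrite -big_split; apply: eq_bigr => i _ /=.
  by rewrite nablaD scalerDr.
by rewrite -big_split; apply: eq_bigr => j _ /=; rewrite -scalerDr.
Qed.

Lemma dnablaZ f w : dnabla D (f *: w) = f *: dnabla D w + dwedge f w.
Proof.
apply: funext => s; rewrite !preformE /dnabla /dwedge scalerDr [RHS]addrAC.
congr (_ + _); rewrite scaler_sumr.
  rewrite -big_split; apply: eq_bigr => i _ /=.
  rewrite nablaZ scalerDr !scalerA.
  by rewrite [f * _]mulrC.
apply: eq_bigr => i _; rewrite scaler_sumr; apply: eq_bigr => j _.
by rewrite preformE !scalerA mulrC.
Qed.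

Lemma dnabla0 : dnabla D (0 : preform V) = 0.
Proof.
by apply: (addrI (dnabla D (0 : preform V))); rewrite -dnablaD !addr0.
Qed.

Lemma dnablaN w : dnabla D (- w) = - dnabla D w.
Proof. by apply/eqP; rewrite -addr_eq0 -dnablaD addNr dnabla0. Qed.

Lemma dnablaB v w : dnabla D (v - w) = dnabla D v - dnabla D w.
Proof. by rewrite dnablaD dnablaN. Qed.

Lemma dnabla_alt w : alt_form w -> alt_form (dnabla D w).
Proof.
move=> aw; split=> [s t f Y Z|Y s t u].
  elim: s w aw => [|X' s IH] w aw /=; last first.
    rewrite !dnabla_cons // !IH //; last exact: contract_alt.
    have [lw _] := lie_der_alt X' aw.
    by rewrite lw scalerBr; zmod_cancel.
  have cE : contract (f *: Y + Z) w = f *: contract Y w + contract Z w.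
    by apply: funext => s; exact: alt_form_lincons.
  (* Both [L_(f Y) w] and [d (f i_Y w)] contribute the wedge of [df] with [i_Y w], and these
     cancel. *)
  rewrite !dnabla_cons // cE dnablaD dnablaZ lie_derDl // lie_derZl //.
  by rewrite !preformE scalerBr; zmod_cancel.
elim: s w aw => [|X' s IH] w aw /=; last first.
  rewrite dnabla_cons // IH; last exact: contract_alt.
  by have [_ ->] := lie_der_alt X' aw; rewrite subr0.
elim: t w aw => [|Z t IH] w aw /=.
  rewrite dnabla_cons // lie_der_cons dnabla_cons; last exact: contract_alt.
  have c0 : contract Y (contract Y w) = 0.
    by apply: funext => s'; have [_ zw] := aw; exact: (zw Y [::] [::]).
  rewrite c0 liexx dnabla0 /contract (@alt_form0 _ _ _ _ [::]) //.
  rewrite !subr0 subrr.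
  zmod_cancel.
have aZ := contract_alt Z aw; have [_ zw] := aw.
rewrite dnabla_cons // lie_der_cons dnabla_cons; last exact: contract_alt.
rewrite contract_cons2 // dnablaN preformE opprB opprD.
(* By induction [d (i_Z w)] vanishes on [Y :: t ++ Y :: u], so Cartan's formula equates
   [L_Y (i_Z w)] and [d (i_Y i_Z w)] on [t ++ Y :: u]. *)
have := IH _ aZ; rewrite /= dnabla_cons // => /eqP; rewrite subr_eq0 => /eqP ->.
(* What remains is [w] with [Y] and a bracket of [Y] and [Z] in exchanged slots. *)
rewrite (lie_der_dup Z); last by move=> *; exact: (zw Y [::]).
rewrite /contract -[lie Y Z :: _ ++ _]cat_cons (alt_form_front (_ :: _)) //=.
rewrite -[Y :: t ++ _]cat_cons (alt_form_front (_ :: _)) //=.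
rewrite (alt_form_swap _ (lie Z Y)) //= (lieC Z Y).
rewrite (@alt_formN _ _ _ _ [:: Y]) //= !scalerN.
zmod_cancel.
Qed.

End CartanCalculus.

(** * Commutation rules of the Cartan calculus, and degrees *)

Section CartanIdentities.
Variables (R : realType) (M : manifold R) (V : vector_bundle M).
Variable D : linear_connection V.
Implicit Types (f g : C^oo(M)) (X Y Z : Gamma (TM M)).
Implicit Types (s t u : seq (Gamma (TM M))) (v w : preform V).

Lemma contractD X v w : contract X (v + w) = contract X v + contract X w.
Proof. by []. Qed.

Lemma contractN X w : contract X (- w) = - contract X w.
Proof. by []. Qed.

Lemma contract_subl X Y w : alt_form w ->
  contract (X - Y) w = contract X w - contract Y w.
Proof.
move=> aw; apply: funext => s; rewrite /contract (@alt_formD _ _ _ _ [::]) //.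
by rewrite (@alt_formN _ _ _ _ [::]).
Qed.

Lemma contract_dwedge X f w :
  contract X (dwedge f w) = vf_app X f *: w - dwedge f (contract X w).
Proof. by apply: funext => s; exact: dwedge_cons. Qed.

(** The difference [d (f w) - f d w] is the wedge, so alternation is inherited from [d]. *)
Lemma dwedge_alt f w : alt_form w -> alt_form (dwedge f w).
Proof.
move=> aw; have -> : dwedge f w = dnabla D (f *: w) - f *: dnabla D w.
  by rewrite dnablaZ addrC addKr.
apply: add_alt; first exact/dnabla_alt/scale_alt.
exact/opp_alt/scale_alt/dnabla_alt.
Qed.

Lemma lie_der_dwedge X f w : alt_form w ->
  lie_der D X (dwedge f w)
    = dwedge (vf_app X f) w + dwedge f (lie_der D X w).
Proof.
move=> aw; apply: funext => s; elim: s w aw => [|Y s IH] w aw.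
  by rewrite lie_der_nil preformE !dwedge_nil nabla0 addr0.
rewrite lie_der_cons !contract_dwedge lie_derD lie_derN lie_derZ.
rewrite !preformE IH; last exact: contract_alt.
rewrite !dwedge_cons contract_lie_der dwedgeD dwedgeN !preformE.
rewrite vf_app_lie scalerBl; zmod_cancel.
Qed.

(** The sign rule for [d] across the one-form [df], which is closed. *)
Lemma dnabla_dwedge f w : alt_form w ->
  dnabla D (dwedge f w) = - dwedge f (dnabla D w).
Proof.
move=> aw; apply: funext => s; elim: s w aw => [|Y s IH] w aw.
  by rewrite preformE dnabla_nil dwedge_nil oppr0.
rewrite dnabla_cons; last exact: dwedge_alt.
rewrite contract_dwedge dnablaB dnablaZ lie_der_dwedge //.
rewrite !preformE IH; last exact: contract_alt.
rewrite dwedge_cons contract_dnabla // dwedgeD dwedgeN !preformE.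
zmod_cancel.
Qed.

Lemma lie_der_comm X Y w :
  (forall e, curvature (@lie R M) D X Y e = 0) -> alt_form w ->
  lie_der D X (lie_der D Y w)
    = lie_der D Y (lie_der D X w) + lie_der D (lie X Y) w.
Proof.
move=> RXY aw; apply: funext => s; elim: s w aw => [|Z s IH] w aw.
  (* Without arguments the identity is [R(X, Y) = 0] on the section [w [::]]. *)
  rewrite preformE !lie_der_nil; apply/eqP; rewrite -subr_eq0 opprD addrA.
  exact/eqP/RXY.
rewrite preformE !lie_der_cons !contract_lie_der !(lie_derD, lie_derN).
rewrite !preformE IH; last exact: contract_alt.
by rewrite lie_jacobi contract_subl // !preformE; zmod_cancel.
Qed.

Lemma lie_der_dnabla X w :
  (forall Y e, curvature (@lie R M) D X Y e = 0) -> alt_form w ->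
  lie_der D X (dnabla D w) = dnabla D (lie_der D X w).
Proof.
move=> RX aw; apply: funext => s; elim: s w aw => [|Y s IH] w aw.
  by rewrite lie_der_nil !dnabla_nil nabla0.
rewrite lie_der_cons dnabla_cons; last exact: lie_der_alt.
rewrite contract_lie_der !contract_dnabla // lie_derD lie_derN dnablaB.
rewrite !preformE IH; last exact: contract_alt.
(* The two sides differ by [[L_X, L_Y] w - L_[X,Y] w], with [Y] the head of the list; hence the
   hypothesis on every [Y]. *)
by rewrite lie_der_comm // !preformE; zmod_cancel.
Qed.

Lemma dnabla_dnabla w : flat D -> alt_form w -> dnabla D (dnabla D w) = 0.
Proof.
move=> flatD aw; apply: funext => s; elim: s w aw => [|X s IH] w aw.
  exact: dnabla_nil.
rewrite dnabla_cons; last exact: dnabla_alt.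
(* Cartan's formula twice: [i_X d d w = L_X d w - d L_X w + d d (i_X w)]. *)
rewrite contract_dnabla // dnablaB lie_der_dnabla //.
rewrite !preformE IH; last exact: contract_alt.
by rewrite subr0 subrr.
Qed.

(** The Leibniz rule on [1 * 1] gives [X 1 = 2 X 1], hence [X 1 = 0]; linearity does the rest. *)
Lemma vf_app_cst X (c : R) : vf_app X (sfun_cst c) = 0.
Proof.
apply: sfunE => x /=; have := tan_leibniz (X x) 1 1.
rewrite mulr1 /= !mul1r => /eqP; rewrite -subr_eq0 opprD addNKr oppr_eq0.
move=> /eqP X1; have := tan_linear (X x) c 1 0.
have := tanD (X x) 0 0; rewrite addr0 => /eqP.
rewrite -subr_eq0 opprD addNKr oppr_eq0 => /eqP ->.
by rewrite !addr0 mulr1 X1 mulr0.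
Qed.

Lemma dwedge_cst (c : R) w : dwedge (sfun_cst c) w = 0.
Proof.
apply: funext => s; rewrite /dwedge big1 // => i _.
by rewrite vf_app_cst scale0r scaler0.
Qed.

Lemma OmegaP (d : int) w :
  Omega V d w <-> alt_form w /\ (forall s, (size s)%:Z != d -> w s = 0).
Proof. by split=> [[? ? ?]|[[? ?] ?]]; split. Qed.

Lemma Omega_alt (d : int) w : Omega V d w -> alt_form w.
Proof. by move=> /OmegaP[]. Qed.

Lemma OmegaB (d : int) v w : Omega V d v -> Omega V d w -> Omega V d (v - w).
Proof.
move=> /OmegaP[av dv] /OmegaP[aw dw]; apply/OmegaP; split.
  exact/add_alt/opp_alt.
by move=> s sd; rewrite !preformE dv // dw // subrr.
Qed.

Lemma size_drop_at i s : (i < size s)%N -> (size (drop_at i s)).+1 = size s.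
Proof.
move=> lis; rewrite size_cat size_drop size_takel; last exact: ltnW.
by rewrite -addnS subnSK // subnKC // ltnW.
Qed.

Lemma dnabla_Omega (d : int) w : Omega V d w -> Omega V (d + 1) (dnabla D w).
Proof.
move=> /OmegaP[aw dw]; apply/OmegaP; split; first exact: dnabla_alt.
move=> s sd.
have w0 t : (size t).+1 = size s -> w t = 0.
  move=> ts; apply: dw; apply: contra sd => /eqP <-.
  by rewrite -ts -addn1 PoszD.
rewrite /dnabla !big1 ?addr0 // => i _.
  rewrite big1 // => j _; rewrite w0 ?scaler0 //=.
  have di := size_drop_at (ltn_ord i).
  (* Two arguments are dropped and one bracket is added, so the list is again one shorter than
     [s]. *)
  by rewrite size_drop_at // -ltnS di (leq_ltn_trans (ltn_ord j)).
by rewrite w0 ?nabla0 ?scaler0 // size_drop_at.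
Qed.

End CartanIdentities.

(** * IM forms under an invariant connection *)

Section InvariantConnection.
Variables (R : realType) (M : manifold R) (A : lie_algebroid M).
Variables (V : vector_bundle M) (DA : representation A V).
Variable D : linear_connection V.
Hypothesis D_invariant : A_invariant DA D.
Implicit Types (a b : Gamma A) (w : preform V).

Lemma Lie_lie_der a w : Lie DA a w = lie_der D (rho a) w.
Proof.
apply: funext => s; rewrite /Lie lie_derE; congr (_ - _).
by apply: sectE => x; have [+ _] := D_invariant; apply.
Qed.

Lemma curvature_rho a Y e : curvature (@lie R M) D (rho a) Y e = 0.
Proof.
apply: sectE => x; have [_ Rx] := D_invariant.
exact: (Rx x (a x) (Y x) (rho a) Y).
Qed.

Lemma d_IM_Omega_IM k (Ll : IM_pair A V) :
  Omega_IM DA k Ll -> Omega_IM DA k.+1 (d_IM D Ll).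
Proof.
case: Ll => L l [/= FL L_lin Fl l_lin L_leib l_contr L_br l_br].
have aL a := Omega_alt (FL a); have al a := Omega_alt (Fl a).
have FL' a : Omega V k.+1%:Z (dnabla D (L a)).
  by rewrite -addn1 PoszD; exact: dnabla_Omega.
have L_br' a b : L (bracket a b)
    = lie_der D (rho a) (L b) - lie_der D (rho b) (L a).
  by rewrite L_br !Lie_lie_der.
have l_br' a b : l (bracket a b)
    = lie_der D (rho a) (l b) - contract (rho b) (L a).
  by rewrite l_br Lie_lie_der.
have lD a b : l (a + b) = l a + l b by have := l_lin 1 a b; rewrite !scale1r.
have LD a b : L (a + b) = L a + L b.
  by have := L_lin 1 a b; rewrite (_ : sfun_cst 1 = 1) // !scale1r.
have lN a : l (- a) = - l a.
  apply/eqP; rewrite -addr_eq0 -lD addNr; apply/eqP/(addrI (l 0)).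
  by rewrite -lD !addr0.
split=> /=.
- exact: FL'.
- by move=> c a b; rewrite L_lin dnablaD dnablaZ dwedge_cst addr0.
- move=> a; rewrite -addn1 PoszD addrK; apply: OmegaB => //.
  (* Degrees are integers, so [(k - 1) + 1 = k] also for [k = 0]. *)
  by rewrite -[k%:Z](subrK 1); exact: dnabla_Omega.
(* The wedge of [df] with [l a] in [L (f *: a)] cancels the one in [d (f l a)], so the difference is
   linear over functions. *)
- move=> f a b; rewrite l_lin LD L_leib dnablaD dnablaZ scalerBr.
  zmod_cancel.
- move=> f a; rewrite L_leib dnablaD dnablaZ dnabla_dwedge // dwedgeD dwedgeN.
  zmod_cancel.
- move=> a b; rewrite !contractD !contractN !contract_dnabla //.
  (* The bracket axiom for [l], solved for the contraction of [L]; substituting it makes the whole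
     expression antisymmetric in [a] and [b]. *)
  have cL a' b' : contract (rho a') (L b')
      = lie_der D (rho b') (l a') - l (bracket b' a').
    by rewrite l_br'; zmod_cancel.
  rewrite !cL (bracket_antisym b a) lN (l_contr a b) dnablaN.
  zmod_cancel.
- move=> a b; rewrite !Lie_lie_der L_br' dnablaB.
  by rewrite !lie_der_dnabla //; exact: curvature_rho.
(* Cartan's formula for [i_(rho b) d (L a)] supplies both [L_(rho b) (L a)] and
   [d (i_(rho b) (L a))]. *)
- move=> a b; rewrite Lie_lie_der L_br' l_br' contract_dnabla // dnablaB.
  rewrite lie_derD lie_derN lie_der_dnabla //; last exact: curvature_rho.
  zmod_cancel.
Qed.

End InvariantConnection.

Theorem propositionA10 (R : realType) (M : manifold R) (A : lie_algebroid M)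
    (V : vector_bundle M) (DA : representation A V) (D : linear_connection V)
    (D_invariant : A_invariant DA D) (k : nat) :
  (forall Ll : IM_pair A V, Omega_IM DA k Ll -> Omega_IM DA k.+1 (d_IM D Ll)) /\
  (flat D ->
   forall Ll : IM_pair A V, Omega_IM DA k Ll ->
     d_IM D (d_IM D Ll) = (fun _ => 0, fun _ => 0)).
Proof.
split=> [Ll|flatD [L l] [/= FL _ Fl _ _ _ _ _]]; first exact: d_IM_Omega_IM.
rewrite /d_IM /=; congr pair; apply: funext => a.
  by rewrite dnabla_dnabla //; exact: Omega_alt (FL a).
(* The second component is [d L - d (L - d l) = d d l]. *)
rewrite dnablaB dnabla_dnabla ?subr0 ?subrr //; exact: Omega_alt (Fl a).
Qed.
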